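(* Let $m\ge 2$, and let $\Gamma_m=(V;\mathcal{E}_m,\alpha)$ and $\Gamma'_m=(V';\mathcal{E}_m,\alpha')$ be two simple $m$-graphs. The following properties are equivalent: (i) $\Gamma_m$ is $m$-isomorphic to $\Gamma'_m$; (ii) the associated $R_m$-modules $\mathbb{V}(\Gamma_m)$ and $\mathbb{V}(\Gamma'_m)$ are isomorphic; (iii) the representations $\rho_{\Gamma_m}$ and $\rho_{\Gamma'_m}$ of $\mathbb{E}_m$ are equivalent.
   Context: Graphs are finite. A graph is a triple $(V;E,\varepsilon)$ with vertex set $V$, edge set $E$ and a map $\varepsilon$ from $E$ to the set of subsets of $V$ with one or two elements; it is simple if every $\varepsilon(e)$ has exactly two elements and $\varepsilon$ is injective. Let $\mathcal{E}_m=\{1,2,\dots,m\}$. An $m$-graph is a graph $(V;\mathcal{E}_m,\alpha)$ whose edge set is $\mathcal{E}_m$. Two $m$-graphs $(V;\mathcal{E}_m,\alpha)$ and $(V';\mathcal{E}_m,\alpha')$ are $m$-isomorphic if there is a bijection $f:V\to V'$ with $\alpha'(i)=f(\alpha(i))$ for all $i\in\mathcal{E}_m$. Fix an odd prime $p$ and an algebraic closure $\overline{\mathbb{F}}_p$ of $\mathbb{F}_p$. Let $\mathbb{E}_m=\mathbb{F}_2[\mathcal{E}_m]$ be the $\mathbb{F}_2$-vector space with basis $\mathcal{E}_m$, viewed as an abelian group (law written $\oplus$), and $R_m=\overline{\mathbb{F}}_p[\mathbb{E}_m]$ its group algebra. For $a=\oplus_{i}a_i\, i\in\mathbb{E}_m$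 ($a_i\in\{0,1\}$), $\chi_a:\mathbb{E}_m\to\{\pm1\}\subset\mathbb{F}_p^\times$ is the homomorphism with $\chi_a(i)=(-1)^{a_i}$ on the basis. For a simple $m$-graph $\Gamma_m=(V;\mathcal{E}_m,\alpha)$ define $\gamma:V\to\mathbb{E}_m$ by $\gamma(x)=\oplus_{i:\,x\in\alpha(i)}i$. Let $\mathbb{V}(\Gamma_m)=\overline{\mathbb{F}}_p[V]$ be the $\overline{\mathbb{F}}_p$-vector space with basis $V$. The representation $\rho_{\Gamma_m}:\mathbb{E}_m\to GL(\mathbb{V}(\Gamma_m))$ is defined by $\rho_{\Gamma_m}(a)(x)=\chi_{\gamma(x)}(a)\,x$ for $a\in\mathbb{E}_m$, $x\in V$, extended linearly, and it makes $\mathbb{V}(\Gamma_m)$ an $R_m$-module. Two representations $\rho:\mathbb{E}_m\to GL(W)$ and $\rho':\mathbb{E}_m\to GL(W')$ over $\overline{\mathbb{F}}_p$ are equivalent if there is an $\overline{\mathbb{F}}_p$-linear isomorphism $\varphi:W\to W'$ with $\varphi\circ\rho(a)=\rho'(a)\circ\varphi$ for all $a\in\mathbb{E}_m$. *)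

(* Defs.v *)
From HB Require Import structures.
From mathcomp Require Import all_boot all_order all_algebra all_field.

Set Implicit Arguments.
Unset Strict Implicit.
Unset Printing Implicit Defensive.

Import GRing.Theory.
Local Open Scope ring_scope.

Record graph (E : finType) := Graph {
  vertex :> finType;
  ends : E -> {set vertex};
  ends_card : forall e, (0 < #|ends e| <= 2)%N
}.

Definition simple_graph (E : finType) (g : graph E) : Prop :=
  (forall e, #|ends g e| = 2) /\ injective (ends g).

(* The edge set {1, ..., m} is encoded as 'I_m = {0, ..., m - 1}. *)
Notation mgraph m := (graph 'I_m).

Definition m_isomorphic (m : nat) (g g' : mgraph m) : Prop :=
  exists f : g -> g', bijective f /\ forall i, ends g' i = f @: ends g i.

(* The F_2-vector space with basis 'I_m, as formal combinations of edges. *)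
Definition edge_space (m : nat) := {ffun 'I_m -> ('F_2)^o}.
HB.instance Definition _ (m : nat) := GRing.Lmodule.on (edge_space m).
HB.instance Definition _ (m : nat) := Finite.on (edge_space m).

Section Indicator.

Variables (R : nzRingType) (T : finType).

Definition basis_vector (x : T) : {ffun T -> R^o} := [ffun y => (y == x)%:R].

Lemma basis_vector_sum (f : {ffun T -> R^o}) :
  f = \sum_x f x *: basis_vector x.
Proof.
apply/ffunP => y; rewrite sum_ffunE (bigD1 y) //= big1 => [|x xy].
  by rewrite !ffunE eqxx addr0 /GRing.scale /= mulr1.
by rewrite !ffunE eq_sym (negPf xy) /GRing.scale /= mulr0.
Qed.

End Indicator.

(* The product is convolution: {ffun G -> K} also has a pointwise product,
   hence the separate name. *)
Definition group_algebra (K : fieldType) (G : finZmodType) := {ffun G -> K^o}.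

Section GroupAlgebra.

Variables (K : fieldType) (G : finZmodType).

HB.instance Definition _ := GRing.Lmodule.on (group_algebra K G).

Implicit Types u v w : group_algebra K G.

Definition galg_one : group_algebra K G := basis_vector K (0 : G).
Definition galg_mul u v : group_algebra K G :=
  [ffun c => \sum_a u a * v (c - a)].

Lemma galg_mulA : associative galg_mul.
Proof.
move=> u v w; apply/ffunP => c; rewrite !ffunE.
transitivity (\sum_a \sum_b u a * (v (b - a) * w (c - b))).
  apply: eq_bigr => a _; rewrite ffunE big_distrr /=.
  rewrite (reindex_inj (addIr (- a))) /=; apply: eq_bigr => b _.
  by rewrite opprB addrA subrK.
rewrite exchange_big; apply: eq_bigr => b _ /=.
by rewrite ffunE big_distrl /=; apply: eq_bigr => a _; rewrite mulrA.
Qed.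

Lemma galg_mul1l : left_id galg_one galg_mul.
Proof.
move=> u; apply/ffunP => c; rewrite ffunE (bigD1 0) //= big1 => [|a a0].
  by rewrite ffunE eqxx mul1r subr0 addr0.
by rewrite ffunE (negPf a0) mul0r.
Qed.

Lemma galg_mul1r : right_id galg_one galg_mul.
Proof.
move=> u; apply/ffunP => c; rewrite ffunE (bigD1 c) //= big1 => [|a ac].
  by rewrite ffunE subrr eqxx mulr1 addr0.
by rewrite ffunE subr_eq0 eq_sym (negPf ac) mulr0.
Qed.

Lemma galg_mulDl : left_distributive galg_mul +%R.
Proof.
move=> u v w; apply/ffunP => c; rewrite !ffunE -big_split /=.
by apply: eq_bigr => a _; rewrite ffunE mulrDl.
Qed.

Lemma galg_mulDr : right_distributive galg_mul +%R.
Proof.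
move=> u v w; apply/ffunP => c; rewrite !ffunE -big_split /=.
by apply: eq_bigr => a _; rewrite ffunE mulrDr.
Qed.

Lemma galg_one_neq0 : galg_one != 0.
Proof.
by apply/eqP => /ffunP/(_ 0)/eqP; rewrite !ffunE eqxx oner_eq0.
Qed.

HB.instance Definition _ :=
  GRing.Zmodule_isNzRing.Build (group_algebra K G)
    galg_mulA galg_mul1l galg_mul1r galg_mulDl galg_mulDr galg_one_neq0.

Lemma basis_vector_mul (a b : G) :
  (basis_vector K a : group_algebra K G) * (basis_vector K b : group_algebra K G)
  = (basis_vector K (a + b) : group_algebra K G).
Proof.
apply/ffunP => c; rewrite [in LHS]ffunE (bigD1 a) //= big1 => [|d da].
  by rewrite !ffunE eqxx mul1r addr0 subr_eq addrC.
by rewrite ffunE (negPf da) mul0r.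
Qed.

End GroupAlgebra.

(* A homomorphism G -> GL(W); each rep a is invertible, with inverse
   rep (- a), by the two axioms. *)
Record representation (K : fieldType) (G : finZmodType) (W : lmodType K) :=
  Representation {
    rep :> G -> {linear W -> W};
    rep0 : forall w, rep 0 w = w;
    repD : forall a b w, rep (a + b) w = rep a (rep b w)
  }.

Definition rep_equivalent (K : fieldType) (G : finZmodType) (W W' : lmodType K)
    (rho : representation G W) (rho' : representation G W') : Prop :=
  exists phi : {linear W -> W'},
    bijective phi /\ forall a w, phi (rho a w) = rho' a (phi w).

Definition module_isomorphic (R : pzRingType) (M N : lmodType R) : Prop :=
  exists phi : {linear M -> N}, bijective phi.

(* W, seen as a module over the group algebra through rho. *)
Definition rep_module (K : fieldType) (G : finZmodType) (W : lmodType K)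
  (rho : representation G W) : Type := W.

Section RepModule.

Variables (K : fieldType) (G : finZmodType) (W : lmodType K).
Variable rho : representation G W.

HB.instance Definition _ := GRing.Zmodule.on (rep_module rho).

Definition rep_module_scale (u : group_algebra K G) (w : rep_module rho) :
  rep_module rho := \sum_a u a *: rho a w.

Lemma rep_module_scaleA u v w :
  rep_module_scale u (rep_module_scale v w) = rep_module_scale (u * v) w.
Proof.
rewrite /rep_module_scale.
transitivity (\sum_a \sum_c (u a * v (c - a)) *: rho c w).
  apply: eq_bigr => a _; rewrite linear_sum scaler_sumr /=.
  rewrite [RHS](reindex_inj (addrI a)) /=; apply: eq_bigr => b _.
  by rewrite linearZ /= scalerA repD addrC addKr.
rewrite exchange_big; apply: eq_bigr => c _ /=.
by rewrite [in RHS]ffunE scaler_suml.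
Qed.

Lemma rep_module_scale1 : left_id 1 rep_module_scale.
Proof.
move=> w; rewrite /rep_module_scale (bigD1 0) //= big1 => [|a a0].
  by rewrite ffunE eqxx scale1r rep0 addr0.
by rewrite ffunE (negPf a0) scale0r.
Qed.

Lemma rep_module_scaleDr : right_distributive rep_module_scale +%R.
Proof.
move=> u w w'; rewrite /rep_module_scale -big_split /=.
by apply: eq_bigr => a _; rewrite linearD scalerDr.
Qed.

Lemma rep_module_scaleDl w : {morph rep_module_scale^~ w : u v / u + v}.
Proof.
move=> u v; rewrite /rep_module_scale -big_split /=.
by apply: eq_bigr => a _; rewrite ffunE scalerDl.
Qed.

HB.instance Definition _ :=
  GRing.Zmodule_isLmodule.Build (group_algebra K G) (rep_module rho)
    rep_module_scaleA rep_module_scale1 rep_module_scaleDr rep_module_scaleDl.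

End RepModule.

Definition chi (K : fieldType) (m : nat) (a b : edge_space m) : K :=
  \prod_i (-1) ^+ (a i * b i)%N.

Section Chi.

Variables (K : fieldType) (m : nat).
Implicit Types a b : edge_space m.

Lemma chi0 a : chi K a 0 = 1.
Proof. by rewrite /chi big1 // => i _; rewrite ffunE muln0. Qed.

Lemma chiD a b c : chi K a (b + c) = chi K a b * chi K a c.
Proof.
rewrite /chi -big_split /=; apply: eq_bigr => i _.
rewrite -exprD -mulnDr ffunE.
have -> : ((b i + c i)%R : nat) = odd (b i + c i)%N :> nat by exact: modn2.
by rewrite -signr_odd oddM oddb -oddM signr_odd.
Qed.

Lemma chi_edge a (i : 'I_m) :
  chi K a (basis_vector 'F_2 i : edge_space m) = (-1) ^+ a i.
Proof.
rewrite /chi (bigD1 i) //= big1 => [|j ji]; last first.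
  by rewrite ffunE (negPf ji) muln0.
by rewrite ffunE eqxx muln1 mulr1.
Qed.

End Chi.

Section GraphRepresentation.

Variables (K : fieldType) (m : nat) (g : mgraph m).

Definition incidence (x : g) : edge_space m :=
  \sum_(i | x \in ends g i) (basis_vector 'F_2 i : edge_space m).

Definition vertex_space := {ffun g -> K^o}.
HB.instance Definition _ := GRing.Lmodule.on vertex_space.

Definition graph_action (a : edge_space m) (f : vertex_space) : vertex_space :=
  \sum_x f x *: (chi K (incidence x) a *: basis_vector K x).

Lemma graph_actionE a f x : graph_action a f x = chi K (incidence x) a * f x.
Proof.
rewrite sum_ffunE (bigD1 x) //= big1 => [|y yx].
  by rewrite !ffunE eqxx addr0 /GRing.scale /= mulr1 mulrC.
by rewrite !ffunE eq_sym (negPf yx) /GRing.scale /= !mulr0.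
Qed.

Lemma graph_action_basis a x :
  graph_action a (basis_vector K x) = chi K (incidence x) a *: basis_vector K x.
Proof.
rewrite /graph_action (bigD1 x) //= big1 => [|y yx].
  by rewrite ffunE eqxx scale1r addr0.
by rewrite ffunE (negPf yx) scale0r.
Qed.

Lemma graph_action_is_linear a : linear (graph_action a).
Proof.
move=> k f h; apply/ffunP => x; rewrite !(graph_actionE, ffunE).
by rewrite /GRing.scale /= mulrDr mulrCA.
Qed.

HB.instance Definition _ a :=
  GRing.isLinear.Build K vertex_space vertex_space *:%R (graph_action a)
    (graph_action_is_linear a).

Lemma graph_action0 f : graph_action 0 f = f.
Proof. by apply/ffunP => x; rewrite graph_actionE chi0 mul1r. Qed.

Lemma graph_actionD a b f :
  graph_action (a + b) f = graph_action a (graph_action b f).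
Proof. by apply/ffunP => x; rewrite !graph_actionE chiD mulrA. Qed.

Definition graph_rep : representation (edge_space m) vertex_space :=
  @Representation K (edge_space m) vertex_space
    graph_action graph_action0 graph_actionD.

Definition graph_module : lmodType (group_algebra K (edge_space m)) :=
  rep_module graph_rep.

End GraphRepresentation.

(* Main.v *)
Require Import Defs.
From HB Require Import structures.
From mathcomp Require Import all_boot all_order all_algebra all_field.
From mathcomp Require Import perm.

Set Implicit Arguments.
Unset Strict Implicit.
Unset Printing Implicit Defensive.

Import GRing.Theory.
Local Open Scope ring_scope.

(* In the vertex bases, an equivalence of the two representations is an
   invertible matrix whose (x, y) entry vanishes unless x and y carry the same
   character, that is (as -1 <> 1 in K), unless they are incident to the same
   edges.  A nonzero term in the Leibniz expansion of its determinant is then a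
   bijection between the vertices which preserves incidence. *)

Lemma invertible_mx_transversal (K : fieldType) (n n' : nat)
    (A : 'M[K]_(n, n')) (B : 'M[K]_(n', n)) :
    A *m B = 1%:M -> B *m A = 1%:M ->
  exists s : 'I_n -> 'I_n', bijective s /\ forall i, A i (s i) != 0.
Proof.
move=> AB BA; have nn' : n = n'.
  by apply/eqP; rewrite eqn_leq (mulmx1_min AB) (mulmx1_min BA).
subst n'; have [unitA _] := mulmx1_unit AB.
have [s As0|detA0] := pickP (fun s : 'S_n => [forall i, A i (s i) != 0]).
  exists s; split; last exact/forallP.
  by exists (s^-1)%g; [apply: permK | apply: permKV].
(* Otherwise every permutation meets a zero entry, so all Leibniz terms vanish, against [unitA]. *)
move: unitA; rewrite unitmxE unitfE /determinant big1 ?eqxx // => s _.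
have /negbT := detA0 s; rewrite negb_forall => /existsP[i].
by rewrite negbK => /eqP Ai0; rewrite (bigD1 i) //= Ai0 mul0r mulr0.
Qed.

Lemma linear_basis_vector (K : fieldType) (T : finType) (V : lmodType K)
    (phi : {linear {ffun T -> K^o} -> V}) f :
  phi f = \sum_x f x *: phi (basis_vector K x).
Proof.
rewrite [in LHS](basis_vector_sum f) linear_sum.
by apply: eq_bigr => x _; rewrite linearZ.
Qed.

(** Enumerating [S] and [T] turns [phi] and its inverse into mutually inverse matrices, whose
    transversal is carried back to a bijection. *)
Lemma linear_bij_transversal (K : fieldType) (S T : finType)
    (phi : {linear {ffun S -> K^o} -> {ffun T -> K^o}}) :
    bijective phi ->
  exists f : S -> T, bijective f /\ forall x, phi (basis_vector K x) (f x) != 0.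
Proof.
case=> psi phiK psiK.
pose psiL := GRing.isLinear.Build K _ _ _ psi (can2_linear phiK psiK).
pose psi' : {linear {ffun T -> K^o} -> {ffun S -> K^o}} :=
  HB.pack psi psiL.
(* Rows hold the images of basis vectors, so [A *m B] is the matrix of [psi] after [phi]. *)
pose A := \matrix_(i < #|S|, j < #|T|)
  phi (basis_vector K (enum_val i)) (enum_val j).
pose B := \matrix_(j < #|T|, i < #|S|)
  psi (basis_vector K (enum_val j)) (enum_val i).
have AB : A *m B = 1%:M.
  apply/matrixP => i k; rewrite !mxE.
  have := congr1 (fun f : {ffun S -> K^o} => f (enum_val k))
    (phiK (basis_vector K (enum_val i))).
  rewrite -[psi]/(psi' : _ -> _) linear_basis_vector sum_ffunE.
  rewrite [RHS]ffunE (inj_eq enum_val_inj) eq_sym => <-.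
  rewrite (reindex (@enum_val T predT)) /=; last first.
    by apply: onW_bij; apply: enum_val_bij.
  by apply: eq_bigr => j _; rewrite !mxE !ffunE.
have BA : B *m A = 1%:M.
  apply/matrixP => i k; rewrite !mxE.
  have := congr1 (fun f : {ffun T -> K^o} => f (enum_val k))
    (psiK (basis_vector K (enum_val i))).
  rewrite linear_basis_vector sum_ffunE.
  rewrite [RHS]ffunE (inj_eq enum_val_inj) eq_sym => <-.
  rewrite (reindex (@enum_val S predT)) /=; last first.
    by apply: onW_bij; apply: enum_val_bij.
  by apply: eq_bigr => j _; rewrite !mxE !ffunE.
have [s [s_bij As0]] := invertible_mx_transversal AB BA.
exists (fun x => enum_val (s (enum_rank x))); split.
  apply: bij_comp; first exact: enum_val_bij.
  by apply: bij_comp => //; apply: enum_rank_bij.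
by move=> x; have := As0 (enum_rank x); rewrite mxE enum_rankK.
Qed.

Section RepModuleScaling.

Variables (K : fieldType) (G : finZmodType) (W : lmodType K).
Variable rho : representation G W.

Lemma rep_module_basis_vector (a : G) (w : rep_module rho) :
  (basis_vector K a : group_algebra K G) *: w = rho a w.
Proof.
rewrite /GRing.scale /= /rep_module_scale (bigD1 a) //= big1 => [|b ba].
  by rewrite ffunE eqxx scale1r addr0.
by rewrite ffunE (negPf ba) scale0r.
Qed.

(** [K] embeds in the group algebra as the multiples of its unit, so a module map is also
    [K]-linear. *)
Lemma rep_module_scalar (k : K) (w : rep_module rho) :
  (k *: basis_vector K (0 : G) : group_algebra K G) *: w = k *: (w : W).
Proof.
have coefE b : (k *: basis_vector K (0 : G) : group_algebra K G) b
    = k * (b == 0)%:R by rewrite !ffunE.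
rewrite [LHS]/GRing.scale /= /rep_module_scale (bigD1 0) //= big1 => [|b b0].
  by rewrite coefE eqxx mulr1 rep0 addr0.
by rewrite coefE (negPf b0) mulr0 scale0r.
Qed.

End RepModuleScaling.

(** The group elements span the group algebra over [K], so linearity over it amounts to
    [K]-linearity plus compatibility with [G]; the same underlying map serves both ways. *)
Lemma rep_module_isomorphicP (K : fieldType) (G : finZmodType)
    (W W' : lmodType K) (rho : representation G W)
    (rho' : representation G W') :
  module_isomorphic (rep_module rho : lmodType (group_algebra K G))
    (rep_module rho' : lmodType (group_algebra K G)) <->
  rep_equivalent rho rho'.
Proof.
split=> [[phi phi_bij]|[phi [phi_bij phi_rho]]].
  have phi_linear : linear (phi : W -> W').
    move=> k u v; rewrite -(rep_module_scalar k (u : rep_module rho)).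
    rewrite -(rep_module_scalar k (phi u)).
    exact: (linearP phi).
  pose phiL := GRing.isLinear.Build K W W' _ (phi : W -> W') phi_linear.
  exists (HB.pack (phi : W -> W') phiL : {linear W -> W'}); split=> //= a w.
  rewrite -(rep_module_basis_vector a (w : rep_module rho)).
  exact: etrans (linearZ_LR phi _ _) (rep_module_basis_vector _ _).
have phi_linear : linear (phi : rep_module rho -> rep_module rho').
  move=> u v w; rewrite [LHS](linearD phi); congr (_ + _).
  rewrite /GRing.scale /= /rep_module_scale linear_sum.
  by apply: eq_bigr => a _; rewrite -phi_rho -(linearZ_LR phi).
pose phiL := GRing.isLinear.Build (group_algebra K G) (rep_module rho)
  (rep_module rho') _ (phi : rep_module rho -> rep_module rho') phi_linear.
by exists (HB.pack (phi : rep_module rho -> rep_module rho') phiL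
  : {linear rep_module rho -> rep_module rho'}).
Qed.

Lemma incidenceE (m : nat) (g : mgraph m) (x : g) (i : 'I_m) :
  incidence x i = (x \in ends g i)%:R.
Proof.
rewrite /incidence sum_ffunE big_mkcond (bigD1 i) //= big1 => [|j ji].
  by rewrite ffunE eqxx addr0; case: ifP.
by rewrite ffunE eq_sym (negPf ji); case: ifP.
Qed.

Lemma m_isomorphicP (m : nat) (g g' : mgraph m) :
  m_isomorphic g g' <->
  exists f : g -> g', bijective f /\ forall x, incidence (f x) = incidence x.
Proof.
split=> -[f [f_bij f_inc]]; exists f; split=> //.
  move=> x; apply/ffunP => i.
  by rewrite !incidenceE f_inc (mem_imset _ _ (bij_inj f_bij)).
move=> i; apply/setP => y; have [h fK hK] := f_bij.
(* With [y] written as [f (h y)], both memberships become coordinates of incidence vectors, and 0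
   and 1 differ in ['F_2]. *)
rewrite -(hK y) (mem_imset _ _ (bij_inj f_bij)).
have /ffunP/(_ i) := f_inc (h y); rewrite !incidenceE.
by do 2!case: (_ \in _).
Qed.

(** The value at the edge [i] is -1 to the power [a i], which determines [a i] once -1 and 1
    differ. *)
Lemma chi_inj (K : fieldType) (m : nat) (a b : edge_space m) :
  (2%:R : K) != 0 -> chi K a =1 chi K b -> a = b.
Proof.
move=> two_neq0 ab; apply/ffunP => i.
have := ab (basis_vector 'F_2 i); rewrite !chi_edge.
have N1_neq1 : (-1 : K) != 1 by rewrite eq_sym -subr_eq0 opprK.
have F2P (c : 'F_2) : c = 0 \/ c = 1.
  by case: c => -[|[|//]] lt; [left | right]; apply/val_inj.
case: (F2P (a i)) => ->; case: (F2P (b i)) => -> //=; rewrite ?expr0 ?expr1.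
  by move/esym/eqP; rewrite (negPf N1_neq1).
by move/eqP; rewrite (negPf N1_neq1).
Qed.

Section GraphEquivalence.

Variables (K : fieldType) (m : nat) (g g' : mgraph m).

Lemma m_isomorphic_rep_equivalent :
  m_isomorphic g g' -> rep_equivalent (graph_rep K g) (graph_rep K g').
Proof.
case/m_isomorphicP=> f [[h fK hK] f_inc].
(* Composing with the inverse [h] sends the basis vector of [x] to that of [f x]. *)
pose phi (w : vertex_space K g) : vertex_space K g' := [ffun y => w (h y)].
have phi_linear : linear phi by move=> k u v; apply/ffunP => y; rewrite !ffunE.
pose phiL := GRing.isLinear.Build K _ _ _ phi phi_linear.
exists (HB.pack phi phiL : {linear vertex_space K g -> vertex_space K g'}).
split=> [|a w] /=.
  exists (fun w : vertex_space K g' => [ffun x => w (f x)]) => w.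
    by apply/ffunP => x; rewrite !ffunE fK.
  by apply/ffunP => y; rewrite !ffunE hK.
apply/ffunP => y; rewrite ffunE !graph_actionE ffunE.
by rewrite -[in RHS](hK y) f_inc fK.
Qed.

Lemma rep_equivalent_m_isomorphic : (2%:R : K) != 0 ->
  rep_equivalent (graph_rep K g) (graph_rep K g') -> m_isomorphic g g'.
Proof.
move=> two_neq0 [phi [phi_bij phi_rho]]; apply/m_isomorphicP.
have [f [f_bij f_neq0]] := linear_bij_transversal phi_bij.
exists f; split=> // x; apply: (chi_inj two_neq0) => a.
(* At the coordinate [f x], both sides are the same nonzero entry of [phi], multiplied by the
   character of [x] on one side and of [f x] on the other; cancelling it equates the characters. *)
have := phi_rho a (basis_vector K x); rewrite /= graph_action_basis linearZ /=.
move/ffunP/(_ (f x)); rewrite graph_actionE ffunE.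
by move/(mulIf (f_neq0 x)).
Qed.

End GraphEquivalence.

(* K, with the embedding iota, is an algebraic closure of 'F_p. *)
Theorem theorem6p3 (p : nat) (p_prime : prime p) (p_odd : odd p)
    (K : closedFieldType) (iota : {rmorphism 'F_p -> K})
    (K_algebraic : integralRange iota)
    (m : nat) (m_ge2 : (2 <= m)%N) (g g' : mgraph m)
    (g_simple : simple_graph g) (g'_simple : simple_graph g') :
  (m_isomorphic g g' <->
     module_isomorphic (graph_module K g) (graph_module K g')) /\
  (module_isomorphic (graph_module K g) (graph_module K g') <->
     rep_equivalent (graph_rep K g) (graph_rep K g')).
Proof.
have two_neq0 : (2%:R : K) != 0.
  (* [K] inherits characteristic [p] through [iota], and an odd prime does not divide 2. *)
  have pK : p \in [pchar K] by rewrite (fmorph_pchar iota) pchar_Fp.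
  by rewrite -(dvdn_pcharf pK) dvdn_prime2 //; case: eqP p_odd => // ->.
have mod_rep := rep_module_isomorphicP (graph_rep K g) (graph_rep K g').
split; last exact: mod_rep.
split=> [iso | /mod_rep]; last exact: rep_equivalent_m_isomorphic.
exact/mod_rep/m_isomorphic_rep_equivalent.
Qed.
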